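(* Let $G$ be a graph such that $\operatorname{End}(G)$ is countable and $G$ has infinite endomorphism motion (every nonidentity endomorphism of $G$ moves infinitely many vertices). Let $c$ be a random coloring of $V(G)$ with the two colors black and white, where the colors of the vertices are chosen independently, and suppose there is $\varepsilon > 0$ such that for every vertex $v$ and every color $x \in \{\text{black},\text{white}\}$, $$\varepsilon \leq \operatorname{Prob}[c(v) = x] \leq 1 - \varepsilon.$$ Then almost surely $c$ is distinguishing, i.e. with probability $1$ no endomorphism of $G$ other than the identity preserves $c$.
   Context: Graphs are simple. An endomorphism of $G=(V,E)$ is a map $\phi: V\to V$ such that $\phi(u)\phi(v)\in E$ whenever $uv\in E$; $\operatorname{End}(G)$ is the set of all endomorphisms. A coloring $c$ is preserved by $\phi$ if $c(\phi(v)) = c(v)$ for all $v \in V$. The endomorphism motion of $G$ is the minimum, over nonidentity endomorphisms $\phi$, of the number of vertices $v$ with $\phi(v) \neq v$. *)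

(* Defs.v *)
From HB Require Import structures.
From mathcomp Require Import all_boot all_order all_algebra.
From mathcomp Require Import all_classical all_reals all_analysis.

Set Implicit Arguments.
Unset Strict Implicit.
Unset Printing Implicit Defensive.

Import Order.TTheory GRing.Theory Num.Theory.

Local Open Scope classical_set_scope.

(* The vertex type is arbitrary: finite, countable or uncountable. *)
Record simple_graph (V : Type) := SimpleGraph {
  adj : V -> V -> Prop;
  adj_sym : forall u v, adj u v -> adj v u;
  adj_irrefl : forall v, ~ adj v v }.

Definition endomorphisms (V : Type) (G : simple_graph V) : set (V -> V) :=
  [set phi | forall u v, adj G u v -> adj G (phi u) (phi v)].

Definition moved (V : Type) (phi : V -> V) : set V := [set v | phi v <> v].

(* A graph whose only endomorphism is the identity (where the minimum defining
   the endomorphism motion is over the empty set) satisfies this vacuously. *)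
Definition infinite_endomorphism_motion (V : Type) (G : simple_graph V) :=
  forall phi, endomorphisms G phi -> phi <> id -> infinite_set (moved phi).

Definition preserves (V C : Type) (phi : V -> V) (c : V -> C) :=
  forall v, c (phi v) = c v.

Definition distinguishing (V C : Type) (G : simple_graph V) (c : V -> C) :=
  forall phi, endomorphisms G phi -> preserves phi c -> phi = id.

(* Mutual independence: the product rule over every finite subfamily, a finite
   subfamily of size n being given by an injection of 'I_n into the index
   type. *)
Definition mutually_independent (I : Type) (d d' : measure_display)
    (Omega : measurableType d) (T : measurableType d') (R : realType)
    (P : probability Omega R) (X : I -> {RV P >-> T}) :=
  forall (n : nat) (i : 'I_n -> I) (B : 'I_n -> set T),
    injective i -> (forall k, measurable (B k)) ->
    P (\bigcap_(k in [set: 'I_n]) (X (i k) @^-1` B k)) =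
    (\prod_(k < n) P (X (i k) @^-1` B k))%E.

(* Main.v *)
(* Fix an endomorphism phi moving infinitely many vertices and pick greedily moved
   vertices u_0, u_1, ..., each u_n lying outside the finite set of all u_j and
   phi(u_j) with j < n. The event that phi preserves the colors of
   u_0, ..., u_(n-1), together with the color of phi(u_n), does not involve the
   color of u_n, so requiring c(phi(u_n)) = c(u_n) costs a factor 1 - eps at every
   step. Only u_n has to be fresh: phi(u_n) may have occurred before, so phi need
   not be injective. Hence phi preserves c with probability 0, and there are
   countably many phi. *)

Require Import Defs.
From HB Require Import structures.
From mathcomp Require Import all_boot all_order all_algebra.
From mathcomp Require Import all_classical all_reals all_analysis.

Set Implicit Arguments.
Unset Strict Implicit.
Unset Printing Implicit Defensive.

Import Order.TTheory GRing.Theory Num.Theory.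

Local Open Scope classical_set_scope.
Local Open Scope ring_scope.

Section ColoringEvents.
Context {V : choiceType} {d : measure_display} {Omega : measurableType d}
  {R : realType} {P : probability Omega R}.
Variable c : V -> {RV P >-> bool}.

Lemma measurable_color (v : V) (x : bool) : measurable [set w | c v w = x].
Proof.
have -> : [set w | c v w = x] = c v @^-1` [set x] by [].
by rewrite -[_ @^-1` _]setTI; exact: measurable_funPT.
Qed.

Lemma split_color (v : V) (A : set Omega) : measurable A ->
  P A = (P (A `&` [set w | c v w = true]) + P (A `&` [set w | c v w = false]))%E.
Proof.
move=> mA; rewrite -measureU; first last.
- by apply/seteqP; split => w //= [[_ ->] []].
- exact/measurableI/measurable_color.
- exact/measurableI/measurable_color.
congr (P _); apply/seteqP; split => [w Aw|w [[]|[]]//].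
by case E: (c v w); [left | right].
Qed.

Hypothesis c_indep : mutually_independent c.

(** A duplicate-free list enumerates its vertices injectively through [tnth], so the product rule of
    [mutually_independent] applies to it. *)
Lemma cylinder_prob (s : seq V) (b : V -> bool) : uniq s ->
  P [set w | forall v, v \in s -> c v w = b v] =
  (\prod_(v <- s) P [set w | c v w = b v])%E.
Proof.
move=> us; rewrite big_tnth.
rewrite -(c_indep (i := tnth (in_tuple s))
  (B := fun k => [set b (tnth (in_tuple s) k)])) //; last first.
  exact/tuple_uniqP.
congr (P _); apply/seteqP; split => w /= h.
  by move=> k _ /=; apply/h/mem_tnth.
by move=> v vs; have /tnthP[k ->] : v \in in_tuple s by []; exact: h.
Qed.

(** Dependence on finitely many colors is stated pointwise on outcomes, without a generated
    sigma-algebra, so that colors can be fixed one at a time. *)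
Definition determined_on (s : seq V) (A : set Omega) :=
  forall w w', (forall v, v \in s -> c v w = c v w') -> A w -> A w'.

Lemma color_indep_cylinder (s : seq V) (b : V -> bool) (u : V) (x : bool) :
  uniq (u :: s) ->
  P ([set w | forall v, v \in s -> c v w = b v] `&` [set w | c u w = x]) =
  (P [set w | forall v, v \in s -> c v w = b v] * P [set w | c u w = x])%E.
Proof.
move=> uus; have /andP[us uniq_s] := uus.
(* Overriding [b] at [u] turns the intersection into a single cylinder over [u :: s], whose product
   splits off the factor of [u]. *)
pose b' v := if v == u then x else b v.
have b's v : v \in s -> b' v = b v.
  by move=> vs; rewrite /b'; case: eqP vs us => // -> ->.
transitivity (P [set w | forall v, v \in u :: s -> c v w = b' v]).
  congr (P _); apply/seteqP; split => w /=.
    move=> [h hu] v; rewrite inE => /predU1P[->|vs]; first by rewrite /b' eqxx.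
    by rewrite b's// h.
  move=> h; split; last by rewrite h ?mem_head// /b' eqxx.
  by move=> v vs; rewrite -b's// h// inE vs orbT.
rewrite !cylinder_prob// big_cons muleC {2}/b' eqxx; congr (_ * _)%E.
by apply: eq_big_seq => v /b's ->.
Qed.

Lemma color_indep_determined (s : seq V) (A : set Omega) (u : V) (x : bool) :
  u \notin s -> measurable A -> determined_on s A ->
  P (A `&` [set w | c u w = x]) = (P A * P [set w | c u w = x])%E.
Proof.
move=> us mA dA.
(* Induction on r, conditioning on one more color at a time: t lists the
   vertices whose color is already constant on the event. *)
suff: forall r t B, uniq (u :: r ++ t) -> measurable B ->
    determined_on (r ++ t) B ->
    (forall w w', B w -> B w' -> forall v, v \in t -> c v w = c v w') ->
    P (B `&` [set w | c u w = x]) = (P B * P [set w | c u w = x])%E.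
  move=> /(_ (undup s) [::] A); rewrite cats0; apply=> //.
  - by rewrite /= mem_undup us undup_uniq.
  - by move=> w w' h; apply: dA => v vs; apply: h; rewrite mem_undup.
elim=> [|a r IHr] t B uB mB dB cB.
  (* Base case: the colors on [t] decide membership in [B] and are constant on it, so [B] is empty
     or the cylinder through any of its points [w0]. *)
  have [->|/set0P[w0 Bw0]] := eqVneq B set0; first by rewrite set0I measure0 mul0e.
  have -> : B = [set w | forall v, v \in t -> c v w = c v w0].
    apply/seteqP; split => w /= h; first exact: cB.
    by apply: dB Bw0 => v /h.
  exact: color_indep_cylinder.
have ra : perm_eq (r ++ a :: t) (a :: r ++ t).
  by rewrite perm_catC/= perm_cons perm_catC.
have IH y : P (B `&` [set w | c a w = y] `&` [set w | c u w = x]) =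
    (P (B `&` [set w | c a w = y]) * P [set w | c u w = x])%E.
  apply: (IHr (a :: t)).
  - by rewrite (perm_uniq (_ : perm_eq _ (u :: a :: r ++ t)))// perm_cons.
  - exact/measurableI/measurable_color.
  - move=> w w' h [Bw /= <-]; split.
      by apply: dB Bw => v; rewrite -(perm_mem ra); exact: h.
    by rewrite /= h// mem_cat mem_head orbT.
  - move=> w w' [Bw /= aw] [Bw' /= aw'] v.
    by rewrite inE => /predU1P[->|]; [rewrite aw aw' | exact: cB].
rewrite (split_color a mB) (split_color a (measurableI _ _ mB (measurable_color u x))).
rewrite ge0_muleDl//; congr (_ + _)%E; by rewrite setIAC IH.
Qed.

Section Preserved.
Variables (eps : R) (phi : V -> V).
Hypothesis color_le : forall v x, (P [set w | c v w = x] <= (1 - eps)%:E)%E.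

Definition preserved_on (s : seq V) : set Omega :=
  [set w | forall v, v \in s -> c (phi v) w = c v w].

Lemma preserved_on_cons (u : V) (s : seq V) : preserved_on (u :: s) =
  preserved_on s `&` [set w | c (phi u) w = c u w].
Proof.
apply/seteqP; split => w /=.
  move=> h; split; last exact/h/mem_head.
  by move=> v vs; apply: h; rewrite inE vs orbT.
by move=> [h hu] v; rewrite inE => /predU1P[->|/h].
Qed.

Lemma measurable_preserved_on (s : seq V) : measurable (preserved_on s).
Proof.
elim: s => [|u s IHs].
  by have -> : preserved_on [::] = setT by apply/seteqP; split.
rewrite preserved_on_cons; apply: measurableI => //.
have -> : [set w | c (phi u) w = c u w] = \bigcup_(x in [set: bool])
    ([set w | c (phi u) w = x] `&` [set w | c u w = x]).
  apply/seteqP; split => [w /= h|w [x _ [/= -> ->]]//].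
  by exists (c u w).
apply: fin_bigcup_measurable => // x _.
by apply: measurableI; exact: measurable_color.
Qed.

(** Once the color of [phi u] is fixed to [x], the new constraint reads [c u w = x]. The rest of the
    event depends only on the colors of [phi u], [s] and [map phi s], and [u] is none of these
    vertices, so the constraint costs a factor of at most [1 - eps]. Summing over [x] gives the
    bound. *)
Lemma preserved_on_cons_le (u : V) (s : seq V) :
  phi u <> u -> u \notin s ++ map phi s ->
  (P (preserved_on (u :: s)) <= P (preserved_on s) * (1 - eps)%:E)%E.
Proof.
move=> phiu us; have mA := measurable_preserved_on s.
rewrite (split_color (phi u) (measurable_preserved_on _)).
rewrite [in leRHS](split_color (phi u) mA).
rewrite ge0_muleDl//.
have step x : (P (preserved_on (u :: s) `&` [set w | c (phi u) w = x]) <=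
    P (preserved_on s `&` [set w | c (phi u) w = x]) * (1 - eps)%:E)%E.
  have -> : preserved_on (u :: s) `&` [set w | c (phi u) w = x] =
      preserved_on s `&` [set w | c (phi u) w = x] `&` [set w | c u w = x].
    rewrite preserved_on_cons; apply/seteqP; split => w /=.
      by move=> [[h e] <-].
    by move=> [[h <-] <-].
  rewrite (color_indep_determined (s := phi u :: s ++ map phi s)).
  - exact: lee_wpmul2l.
  - by rewrite inE negb_or us andbT; apply/eqP => /esym.
  - exact/measurableI/measurable_color.
  - move=> w w' h [pw /= <-]; split; last by rewrite /= h// mem_head.
    move=> v vs; rewrite -!h ?pw// inE mem_cat ?vs ?orbT//.
    by rewrite map_f ?orbT.
by apply: leeD.
Qed.

Lemma preserved_on_le (n : nat) : infinite_set (moved phi) ->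
  exists s, (P (preserved_on s) <= ((1 - eps) ^+ n)%:E)%E.
Proof.
move=> infM; elim: n => [|n [s IHs]].
  by exists [::]; rewrite expr0; exact: probability_le1 (measurable_preserved_on _).
have [u [Mu us]] : moved phi `\` [set` s ++ map phi s] !=set0.
  exact/infinite_setN0/infinite_setD/finite_seq.
exists (u :: s); apply: le_trans (preserved_on_cons_le Mu _) _; first exact/negP.
rewrite exprSr EFinM; apply: lee_wpmul2r => //.
exact: le_trans (color_le u true).
Qed.

(** For uncountable [V] the event that [phi] preserves the coloring may fail to be measurable. It is
    therefore covered by a countable intersection of measurable events, of probability at most
    [(1 - eps) ^+ n] for every [n]. *)
Lemma preserves_negligible : 0 < eps -> infinite_set (moved phi) ->
  P.-negligible [set w | preserves phi (c ^~ w)].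
Proof.
move=> eps0 infM.
have [s sP] := choice (fun n => preserved_on_le n infM).
exists (\bigcap_n preserved_on (s n)); split.
- by apply: bigcapT_measurable => n; exact: measurable_preserved_on.
- apply/eqP; rewrite eq_le measure_ge0 andbT.
  (* A vertex is needed to read off [0 <= 1 - eps] from [color_le]. *)
  have [u _] : moved phi !=set0 by exact: infinite_setN0.
  have q0 : 0 <= 1 - eps by rewrite -lee_fin; exact: le_trans (color_le u true).
  have q1 : `|1 - eps| < 1 by rewrite ger0_norm// ltrBlDr ltrDl.
  have cq : ((1 - eps) ^+ n)%:E @[n --> \oo] --> (0 : \bar R).
    by apply: cvg_EFin; [exact: nearW | exact: cvg_expr].
  rewrite -(cvg_lim _ cq)//; apply: lime_ge; first by apply/cvg_ex; eexists; exact: cq.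
  apply: nearW => n; apply: le_trans (sP n); apply: le_measure.
  + by rewrite inE; apply: bigcapT_measurable => m; exact: measurable_preserved_on.
  + by rewrite inE; exact: measurable_preserved_on.
  + by move=> w; apply.
- by move=> w h n _ v _; exact: h.
Qed.

End Preserved.
End ColoringEvents.

(* Colors: true is black, false is white. *)
Theorem theorem4 (V : Type) (G : simple_graph V)
    (d : measure_display) (Omega : measurableType d) (R : realType)
    (P : probability Omega R) (c : V -> {RV P >-> bool}) :
  countable (endomorphisms G) ->
  infinite_endomorphism_motion G ->
  mutually_independent c ->
  (exists2 eps : R, 0 < eps &
    forall (v : V) (x : bool),
      (eps%:E <= P [set w | c v w = x] <= (1 - eps)%:E)%E) ->
  {ae P, forall w, distinguishing G (fun v => c v w)}.
Proof.
move=> cE motion indep [eps eps0 ceps].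
have color_le v x : (P [set w | c v w = x] <= (1 - eps)%:E)%E.
  by have /andP[] := ceps v x.
have /countable_injP[f f_inj] := cE.
(* Indexed by codes, the failures form a countable union; injectivity of [f] on endomorphisms leaves
   at most one [phi] per code. *)
pose F n := [set w | exists2 phi, endomorphisms G phi /\ phi <> id &
  f phi = n /\ preserves phi (c ^~ w)].
apply: (@negligibleS _ _ _ _ (\bigcup_n F n)).
  move=> w /= /existsNP[phi /not_implyP[Ephi /not_implyP[pphi phi_id]]].
  by exists (f phi) => //; exists phi.
apply: negligible_bigcup => n.
have [[phi [[Ephi phi_id] fphi]]|noF] :=
    pselect (exists phi, (endomorphisms G phi /\ phi <> id) /\ f phi = n); last first.
  apply: negligibleS (negligible_set0 _) => w [phi Nphi [fphi _]].
  by apply: noF; exists phi.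
(* [{classic V}] equips the arbitrary type [V] with the choice structure assumed for the lemmas
   above. *)
apply: negligibleS (preserves_negligible (V := {classic V}) indep color_le eps0
  (motion _ Ephi phi_id)) => w [psi [Epsi _] [fpsi]].
by rewrite (f_inj psi phi) ?inE// fpsi fphi.
Qed.
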